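(* Let $X,Y,P$ be Banach spaces, $F:X\times P\rightrightarrows Y$ and $G:X\rightrightarrows Y$ set-valued maps, and $(\overline{x},\overline{p},\overline{y})\in X\times P\times Y$ such that $\overline{y}\in F(\overline{x},\overline{p})$ and $-\overline{y}\in G(\overline{x})$. Define $S:P\rightrightarrows X$ by $S(p):=\{x\in X\mid 0\in F(x,p)+G(x)\}$ and $F_{\overline{x}}(\cdot):=F(\overline{x},\cdot)$. Suppose that: (i) $(F,G)$ is locally sum-stable around $((\overline{x},\overline{p}),\overline{y},-\overline{y})$; (ii) $F$ is calm with respect to $x$ uniformly in $p$ at $((\overline{x},\overline{p}),\overline{y})$; (iii) $F_{\overline{x}}$ is metrically regular around $(\overline{p},\overline{y})$; (iv) $G$ is calm at $(\overline{x},-\overline{y})$. Then $S$ is metrically subregular at $(\overline{p},\overline{x})$. Moreover, $$\operatorname{subreg}S(\overline{p},\overline{x})\leq\operatorname{reg}F_{\overline{x}}(\overline{p},\overline{y})\cdot\left[\widehat{\operatorname{clm}}_xF((\overline{x},\overline{p}),\overline{y})+\operatorname{clm}G(\overline{x},-\overline{y})\right].$$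
   Context: $B(x,r)$ is the open ball; $\mathcal{V}(x)$ is the set of neighborhoods of $x$. $d(x,A)=\inf_{a\in A}d(x,a)$ with $d(x,\emptyset)=\infty$; the excess is $e(A,B)=\sup\{d(a,B)\mid a\in A\}$ (with $e(\emptyset,B)=0$). For a multifunction $T$: $\operatorname{Gr}T=\{(x,y)\mid y\in T(x)\}$, $T^{-1}(y)=\{x\mid y\in T(x)\}$. $F_p(\cdot):=F(\cdot,p)$. For $T:X\rightrightarrows Y$, $(\overline{x},\overline{y})\in\operatorname{Gr}T$ and $L>0$: - $T$ is calm with constant $L$ at $(\overline{x},\overline{y})$ if there exist $U\in\mathcal{V}(\overline{x})$, $V\in\mathcal{V}(\overline{y})$ with $e(T(x)\cap V,T(\overline{x}))\leq L\,d(x,\overline{x})$ for every $x\in U$; $\operatorname{clm}T(\overline{x},\overline{y})$ is the infimum of such $L$. - $T$ is metrically subregular with constant $L$ at $(\overline{x},\overline{y})$ if there exists $U\in\mathcal{V}(\overline{x})$ with $d(x,T^{-1}(\overline{y}))\leq L\,d(\overline{y},T(x))$ for every $x\in U$; $\operatorname{subreg}T(\overline{x},\overline{y})$ is the infimum of such $L$. - $T$ is metrically regular around $(\overline{x},\overline{y})$ with constant $L$ if there exist $U\in\mathcal{V}(\overline{x})$, $V\in\mathcal{V}(\overline{y})$ with $d(x,T^{-1}(y))\leq L\,d(y,T(x))$ for every $(x,y)\in U\times V$; $\operatorname{reg}T(\overline{x},\overline{y})$ is the infimum of such $L$. $F$ is calm with respect to $x$ uniformly in $p$ at $((\overline{x},\overline{p}),\overline{y})$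 with constant $L>0$ if there exist $U\in\mathcal{V}(\overline{x})$, $V\in\mathcal{V}(\overline{p})$, $W\in\mathcal{V}(\overline{y})$ such that $e(F(x,p)\cap W,F(\overline{x},p))\leq L\,d(x,\overline{x})$ for all $x\in U$, $p\in V$; the infimum of such $L$ is $\widehat{\operatorname{clm}}_xF((\overline{x},\overline{p}),\overline{y})$. For $\overline{y}\in F(\overline{x},\overline{p})$, $\overline{z}\in G(\overline{x})$, $(F,G)$ is locally sum-stable around $((\overline{x},\overline{p}),\overline{y},\overline{z})$ if for every $\varepsilon>0$ there exists $\delta>0$ such that, for every $(x,p)\in B(\overline{x},\delta)\times B(\overline{p},\delta)$ and every $w\in(F_p+G)(x)\cap B(\overline{y}+\overline{z},\delta)$, there exist $y\in F_p(x)\cap B(\overline{y},\varepsilon)$ and $z\in G(x)\cap B(\overline{z},\varepsilon)$ such that $w=y+z$. Here $(F_p+G)(x)=F(x,p)+G(x)$ (Minkowski sum). A property without mention of a constant means that it holds for some $L>0$. *)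

(* Defs.v *)
From HB Require Import structures.
From mathcomp Require Import all_boot all_order all_algebra.
From mathcomp Require Import all_classical all_reals all_analysis.

Set Implicit Arguments.
Unset Strict Implicit.
Unset Printing Implicit Defensive.

Import Order.TTheory GRing.Theory Num.Theory.
Import numFieldNormedType.Exports.

Local Open Scope classical_set_scope.
Local Open Scope ring_scope.

(* A multifunction from X to Y is a function T : X -> set Y.  The distance
   from a point x to a set A is the library's [edist_inf A x], which is +oo
   when A is empty; the next lemma checks that it is built from the norm. *)
Lemma edist_infE (R : realType) (X : normedModType R) (A : set X) (x : X) :
  edist_inf A x = ereal_inf [set `|x - a|%:E | a in A].
Proof.
rewrite /edist_inf; congr ereal_inf; apply: eq_imagel => a _.
apply/eqP; rewrite eq_le; apply/andP; split; last first.
  apply: le_ereal_inf_tmp => _ [r [_ xar] <-]; rewrite lee_fin.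
  by move: xar; rewrite -ball_normE => /ltW.
apply/lee_addgt0Pr => e e0; apply: ereal_inf_lbound.
exists (`|x - a| + e) => //; split; first by rewrite ltr_wpDl.
by rewrite -ball_normE /= ltrDl.
Qed.

Section multifunctions.
Context {R : realType}.
Implicit Types X Y P : normedModType R.

Definition Gr X Y (T : X -> set Y) : set (X * Y) := [set xy | T xy.1 xy.2].

Definition multi_inv X Y (T : X -> set Y) (y : Y) : set X := [set x | T x y].

(* [ereal_sup set0] is -oo, whence the case distinction. *)
Definition excess Y (A B : set Y) : \bar R :=
  (if A == set0 then 0 else ereal_sup [set edist_inf B a | a in A])%E.

Definition addset Y (A B : set Y) : set Y :=
  [set w | exists y z, [/\ A y, B z & w = y + z]].

Definition calm_with X Y (T : X -> set Y) (x0 : X) (y0 : Y) (L : R) : Prop :=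
  [/\ Gr T (x0, y0), 0 < L &
   exists U V, [/\ nbhs x0 U, nbhs y0 V &
     forall x, U x ->
       (excess (T x `&` V) (T x0) <= L%:E * `|x - x0|%:E)%E]].

Definition calm X Y (T : X -> set Y) (x0 : X) (y0 : Y) : Prop :=
  exists L, calm_with T x0 y0 L.

Definition clm X Y (T : X -> set Y) (x0 : X) (y0 : Y) : \bar R :=
  ereal_inf [set L%:E | L in calm_with T x0 y0].

Definition subregular_with X Y (T : X -> set Y) (x0 : X) (y0 : Y) (L : R) :
    Prop :=
  [/\ Gr T (x0, y0), 0 < L &
   exists U, nbhs x0 U /\
     forall x, U x ->
       (edist_inf (multi_inv T y0) x <= L%:E * edist_inf (T x) y0)%E].

Definition metrically_subregular X Y (T : X -> set Y) (x0 : X) (y0 : Y) :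
    Prop :=
  exists L, subregular_with T x0 y0 L.

Definition subreg X Y (T : X -> set Y) (x0 : X) (y0 : Y) : \bar R :=
  ereal_inf [set L%:E | L in subregular_with T x0 y0].

Definition regular_with X Y (T : X -> set Y) (x0 : X) (y0 : Y) (L : R) :
    Prop :=
  [/\ Gr T (x0, y0), 0 < L &
   exists U V, [/\ nbhs x0 U, nbhs y0 V &
     forall x y, U x -> V y ->
       (edist_inf (multi_inv T y) x <= L%:E * edist_inf (T x) y)%E]].

Definition metrically_regular X Y (T : X -> set Y) (x0 : X) (y0 : Y) : Prop :=
  exists L, regular_with T x0 y0 L.

Definition reg X Y (T : X -> set Y) (x0 : X) (y0 : Y) : \bar R :=
  ereal_inf [set L%:E | L in regular_with T x0 y0].

Definition ucalm_with X P Y (F : X * P -> set Y) (x0 : X) (p0 : P) (y0 : Y)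
    (L : R) : Prop :=
  0 < L /\
  exists U V W, [/\ nbhs x0 U, nbhs p0 V, nbhs y0 W &
    forall x p, U x -> V p ->
      (excess (F (x, p) `&` W) (F (x0, p)) <= L%:E * `|x - x0|%:E)%E].

Definition ucalm X P Y (F : X * P -> set Y) (x0 : X) (p0 : P) (y0 : Y) :
    Prop :=
  exists L, ucalm_with F x0 p0 y0 L.

Definition uclm X P Y (F : X * P -> set Y) (x0 : X) (p0 : P) (y0 : Y) :
    \bar R :=
  ereal_inf [set L%:E | L in ucalm_with F x0 p0 y0].

Definition locally_sum_stable X P Y (F : X * P -> set Y) (G : X -> set Y)
    (x0 : X) (p0 : P) (y0 z0 : Y) : Prop :=
  [/\ F (x0, p0) y0, G x0 z0 &
   forall eps : R, 0 < eps -> exists2 delta : R, 0 < delta &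
     forall x p w, ball x0 delta x -> ball p0 delta p ->
       (addset (F (x, p)) (G x) `&` ball (y0 + z0) delta) w ->
       exists y z, [/\ (F (x, p) `&` ball y0 eps) y,
                       (G x `&` ball z0 eps) z & w = y + z]].

Definition solution_map X P Y (F : X * P -> set Y) (G : X -> set Y) (p : P) :
    set X :=
  [set x | addset (F (x, p)) (G x) 0].

End multifunctions.

(* Main.v *)
(** Let [k], [l], [m] be constants of regularity and calmness. If [x] solves the
    problem at [p] near [pbar], sum-stability writes [0 = y + z] with [y] in
    [F (x, p)] near [ybar] and [z = - y] in [G x]. Calmness moves [y] to [y'] in
    [F (xbar, p)] and [- y] to [z'] in [G xbar], at cost [l] and [m] times
    [`|x - xbar|]; regularity at [(p, - z')] then gives a [q] with [- z'] in
    [F (xbar, q)] at distance about [k * `|y' + z'|] from [p], and such a [q]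
    has [xbar] as a solution. Solutions [x] far from [xbar] are harmless, since
    [pbar] itself has [xbar] as a solution. *)
Require Import Defs.
From HB Require Import structures.
From mathcomp Require Import all_boot all_order all_algebra.
From mathcomp Require Import all_classical all_reals all_analysis.
From mathcomp Require Import lra.

Import Order.TTheory GRing.Theory Num.Theory.
Import numFieldNormedType.Exports.

Local Open Scope classical_set_scope.
Local Open Scope ring_scope.

Unset Printing Implicit Defensive.

Section distance.
Context {R : realType}.
Implicit Types X Y : normedModType R.

Lemma edist_inf_le X (A : set X) (x a : X) :
  A a -> (edist_inf A x <= `|x - a|%:E)%E.
Proof. by move=> Aa; rewrite edist_infE; apply: ereal_inf_lbound; exists a. Qed.

Lemma edist_inf_ltP X (A : set X) (x : X) (r : R) :
  (edist_inf A x < r%:E)%E -> exists2 a, A a & `|x - a| < r.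
Proof.
rewrite edist_infE => /ereal_inf_lt[_ [a Aa <-]]; rewrite lte_fin => ar.
by exists a.
Qed.

Lemma le_edist_inf X (A B : set X) (x : X) :
  A `<=` B -> (edist_inf B x <= edist_inf A x)%E.
Proof.
by move=> AB; rewrite !edist_infE; apply: ereal_inf_le_tmp; apply: image_subset.
Qed.

(** The infimum that defines the distance to [B] need not be attained, so an actual point of [B]
    costs a strict slack [M < r]. *)
Lemma excess_ltP Y (A B : set Y) (a : Y) (M r : R) :
  (excess A B <= M%:E)%E -> A a -> M < r -> exists2 b, B b & `|a - b| < r.
Proof.
move=> ABM Aa Mr; apply: edist_inf_ltP; apply: (@le_lt_trans _ _ M%:E) => //.
apply: le_trans ABM; rewrite /excess; case: ifPn => [/eqP A0|_].
  by move: Aa; rewrite A0.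
by apply: ereal_sup_ubound; exists a.
Qed.

End distance.

Section inf_product.
Context {R : realType}.
Implicit Types A B C : set R.

Lemma inf_ge0 A : (forall a, A a -> 0 < a) -> 0 <= inf A.
Proof.
move=> A0; have [->|/set0P An0] := eqVneq A set0; first by rewrite inf0.
by apply: lb_le_inf => // a /A0/ltW.
Qed.

(** The infima are taken one variable at a time, each after the other terms and factors are moved to
    the side of [s]. *)
Lemma le_mul_inf_add A B C (s : R) :
  A !=set0 -> B !=set0 -> C !=set0 -> (forall a, A a -> 0 < a) ->
  (forall b, B b -> 0 < b) -> (forall c, C c -> 0 < c) ->
  (forall a b c, A a -> B b -> C c -> s <= a * (b + c)) ->
  s <= inf A * (inf B + inf C).
Proof.
move=> An0 Bn0 Cn0 A0 B0 C0 sABC.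
have sBC b c : B b -> C c -> s <= inf A * (b + c).
  move=> Bb Cc; have bc0 : 0 < b + c by apply: addr_gt0; [exact: B0|exact: C0].
  rewrite -ler_pdivrMr //; apply: lb_le_inf => // a Aa.
  by rewrite ler_pdivrMr ?sABC.
(* Dividing by [inf A] requires it to be positive; if it is zero, the bound already obtained reads
   [s <= 0]. *)
have := inf_ge0 _ A0; rewrite le_eqVlt => /predU1P[A00|iA0].
  have [b Bb] := Bn0; have [c Cc] := Cn0.
  by have := sBC _ _ Bb Cc; rewrite -A00 !mul0r.
rewrite -ler_pdivrMl // -lerBlDr; apply: lb_le_inf => // b Bb.
rewrite lerBlDr -lerBlDl; apply: lb_le_inf => // c Cc.
by rewrite lerBlDl ler_pdivrMl // sBC.
Qed.

End inf_product.

Section subregularity.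
Context {R : realType}.
Variables (X Y P : normedModType R) (F : X * P -> set Y) (G : X -> set Y).
Variables (xbar : X) (pbar : P) (ybar : Y).

Hypothesis h_stable : locally_sum_stable F G xbar pbar ybar (- ybar).

Lemma solution_map_bar : solution_map F G pbar xbar.
Proof. by case: h_stable => Fy Gy _; exists ybar, (- ybar); rewrite subrr. Qed.

Variables (k l m : R).
Hypothesis h_reg : regular_with (fun p => F (xbar, p)) pbar ybar k.
Hypothesis h_ucalm : ucalm_with F xbar pbar ybar l.
Hypothesis h_calm : calm_with G xbar (- ybar) m.

Lemma solution_map_estimate : exists2 d : R, 0 < d &
  forall p x, ball pbar d p -> ball xbar d x -> solution_map F G p x ->
  (edist_inf (multi_inv (solution_map F G) xbar) p
   <= (k * (l + m) * `|xbar - x|)%:E)%E.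
Proof.
case: h_ucalm => l0 [U1 [V1 [W1 [xU1 pV1 yW1 Fcalm]]]].
case: h_calm => _ m0 [U2 [V2 [xU2 yV2 Gcalm]]].
case: h_reg => _ k0 [U3 [V3 [pU3 yV3 Freg]]].
(* Pulling [V2] back by negation lets one ball around [ybar] serve all three neighborhoods in
   [Y]. *)
have yNV2 : nbhs ybar (-%R @^-1` V2) by exact: opp_continuous yV2.
have [r /= r0 ry] := (nbhs_ballP _ _).1 (filterI (filterI yW1 yV3) yNV2).
have [rx /= rx0 xU] := (nbhs_ballP _ _).1 (filterI xU1 xU2).
have [rp /= rp0 pU] := (nbhs_ballP _ _).1 (filterI pV1 pU3).
(* Budget for keeping [- z'] within [r] of [ybar]: [r / 2] for [y], [r / 4] for the calmness of [G],
   [r / 4] for the slack [t]. *)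
have r20 : 0 < r / 2 by rewrite divr_gt0.
case: h_stable => _ _ /(_ _ r20)[ds ds0 stable].
have rm0 : 0 < r / 4 / m by rewrite !divr_gt0.
have [d d0 [d_s d_m d_x d_p]] : exists2 d, 0 < d &
    [/\ d <= ds, d <= r / 4 / m, d <= rx & d <= rp].
  exists (Num.min (Num.min ds (r / 4 / m)) (Num.min rx rp)).
    by rewrite !lt_min ds0 rm0 rx0 rp0.
  by split; rewrite !ge_min lexx ?orbT.
exists d => // p x pd xd Sx.
have [U1x U2x] : (U1 `&` U2) x by exact/xU/(le_ball d_x).
have [V1p U3p] : (V1 `&` U3) p by exact/pU/(le_ball d_p).
have [|||y [z [[Fy yr] [Gz zr] yz]]] := stable x p 0.
- exact: le_ball xd.
- exact: le_ball pd.
- by rewrite subrr; split => //; exact: ballxx.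
have zE : z = - y by apply/eqP; rewrite -addr_eq0 addrC -yz.
subst z; clear yz zr.
have [[W1y _] V2y] : ((W1 `&` V3) `&` (-%R @^-1` V2)) y.
  by apply/ry/(le_ball _ yr); lra.
have mx : m * `|x - xbar| < r / 4.
  rewrite -ltr_pdivlMl // mulrC distrC; apply: lt_le_trans d_m.
  by move: xd; rewrite -ball_normE.
(* The slack [e] enters only now, so [d] does not depend on it. *)
apply/lee_addgt0Pr => e e0.
(* Both calmness moves cost an extra [t], and regularity multiplies by [k]: the first entry ensures
   [k * (2 * t) <= e]. *)
pose t := Num.min (e / (2 * k)) (r / 4).
have t0 : 0 < t by rewrite lt_min !divr_gt0// mulr_gt0.
have [y' Fy' yy'] : exists2 y', F (xbar, p) y' & `|y - y'| < l * `|x - xbar| + t.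
  by apply: (excess_ltP _ _ _ _ _ _ (Fcalm _ _ U1x V1p)) => //; rewrite ltrDl.
have [z' Gz' yz'] : exists2 z', G xbar z' & `|- y - z'| < m * `|x - xbar| + t.
  by apply: (excess_ltP _ _ _ _ _ _ (Gcalm _ U2x)) => //; rewrite ltrDl.
have {}yz' : `|y - - z'| < m * `|x - xbar| + t by rewrite -normrN opprB addrC.
have V3z : V3 (- z').
  suff [[_ ?] _] : ((W1 `&` V3) `&` (-%R @^-1` V2)) (- z') by [].
  apply: ry; move: yr; rewrite -!ball_normE /= => yr.
  have tr : t <= r / 4 by rewrite ge_min lexx orbT.
  have := ler_distD y ybar (- z'); lra.
apply: (@le_trans _ _ (edist_inf (multi_inv (fun p => F (xbar, p)) (- z')) p)).
  by apply: le_edist_inf => q Fq; exists (- z'), z'; rewrite addNr.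
apply: le_trans (Freg _ _ U3p V3z) _.
apply: (@le_trans _ _ (k%:E * `|- z' - y'|%:E)%E).
  by rewrite lee_pmul2l ?lte_fin// edist_inf_le.
rewrite -EFinM -EFinD lee_fin.
have te : k * (2 * t) <= e.
  rewrite mulrA (mulrC k) -ler_pdivlMl ?mulr_gt0// [leRHS]mulrC.
  by rewrite ge_min lexx.
have zy' : `|- z' - y'| <= (l + m) * `|xbar - x| + 2 * t.
  rewrite (distrC xbar).
  have := ler_distD y (- z') y'; rewrite (distrC (- z') y); lra.
apply: le_trans (ler_wpM2l (ltW k0) zy') _.
by rewrite mulrDr mulrA lerD2l.
Qed.

Lemma solution_map_subregular_with :
  subregular_with (solution_map F G) pbar xbar (k * (l + m)).
Proof.
have [d d0 est] := solution_map_estimate.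
case: h_ucalm h_calm h_reg => l0 _ [_ m0 _] [_ k0 _].
have L0 : 0 < k * (l + m) by rewrite mulr_gt0// addr_gt0.
split => //; first exact: solution_map_bar.
(* The second entry handles solutions with [d <= |xbar - x|]: for them
   [|p - pbar| < k * (l + m) * d] suffices. *)
exists (ball pbar (Num.min d (k * (l + m) * d))); split.
  by apply: nbhsx_ballx; rewrite lt_min d0 mulr_gt0.
(* With the constant moved to the left, it suffices to treat each solution [x] separately; an empty
   solution set is covered vacuously. *)
move=> p pd; rewrite -lee_pdivrMl// [leRHS]edist_infE.
apply: le_ereal_inf_tmp => _ [x Sx <-]; rewrite lee_pdivrMl// -EFinM.
have [xd|dx] := ltP `|xbar - x| d.
  apply: est => //; last by rewrite -ball_normE.
  by apply: le_ball pd; rewrite ge_min lexx.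
apply: (@le_trans _ _ `|p - pbar|%:E).
  by apply: edist_inf_le; exact: solution_map_bar.
rewrite lee_fin; apply: (@le_trans _ _ (k * (l + m) * d)).
  rewrite distrC; move: pd; rewrite -ball_normE /= lt_min => /andP[_].
  exact: ltW.
by rewrite ler_pM2l.
Qed.

End subregularity.

Theorem theorem3p11 (R : realType) (X Y P : completeNormedModType R)
    (F : X * P -> set Y) (G : X -> set Y) (xbar : X) (pbar : P) (ybar : Y)
    (hF : F (xbar, pbar) ybar) (hG : G xbar (- ybar))
    (h_stable : locally_sum_stable F G xbar pbar ybar (- ybar))
    (h_ucalm : ucalm F xbar pbar ybar)
    (h_reg : metrically_regular (fun p => F (xbar, p)) pbar ybar)
    (h_calm : calm G xbar (- ybar)) :
  metrically_subregular (solution_map F G) pbar xbar /\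
  (subreg (solution_map F G) pbar xbar <=
    reg (fun p => F (xbar, p)) pbar ybar *
      (uclm F xbar pbar ybar + clm G xbar (- ybar)%R))%E.
Proof.
have [l Fl] := h_ucalm; have [m Gm] := h_calm; have [k Fk] := h_reg.
have hlb (A : set R) : (forall a, A a -> 0 < a) -> has_lbound A.
  by move=> A0; exists 0 => a /A0/ltW.
have reg0 a : regular_with (fun p => F (xbar, p)) pbar ybar a -> 0 < a by case.
have ucalm0 a : ucalm_with F xbar pbar ybar a -> 0 < a by case.
have calm0 a : calm_with G xbar (- ybar) a -> 0 < a by case.
have subreg0 a : subregular_with (solution_map F G) pbar xbar a -> 0 < a by case.
have subregW k' l' m' := @solution_map_subregular_with
  R X Y P F G xbar pbar ybar h_stable k' l' m'.
split; first by exists (k * (l + m)); exact: subregW.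
rewrite /subreg /reg /uclm /clm.
(* All four sets of constants are nonempty and bounded below by 0, so the extended infima are real
   ones and no product of 0 and infinity arises. *)
rewrite !ereal_inf_EFin//; try exact: hlb; last first.
  by exists (k * (l + m)); exact: subregW.
rewrite -EFinD -EFinM lee_fin.
apply: le_mul_inf_add => // a b c Aa Bb Cc.
by apply: ge_inf; [exact: hlb|exact: subregW].
Qed.
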